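(* Let $\mathcal K$ be a multiplicative valued difference field with parameter $\rho$ satisfying Axiom 2. Let $\{a_\eta\}$ be a pc-sequence in $K$ and let $a$ be a pseudo-limit of $\{a_\eta\}$ in some extension, and put $\gamma_\eta:=v(a-a_\eta)$. Let $\Sigma$ be a finite set of $\sigma$-polynomials over $K$, and let $n$ bound the orders of the $\sigma$-polynomials considered; multi-indices range over $\mathbb N^{n+1}$. (1) If $\rho$ is transcendental, then $P(a_\eta)\leadsto P(a)$ for every non-constant $\sigma$-polynomial $P$ over $K$; more precisely there is a unique $\vec L_0=\vec L_0(P)$ such that for every $\vec I\neq\vec L_0$ with $|\vec I|\ge1$, eventually in $\eta$, $$v(P(a_\eta)-P(a))=v(P_{(\vec L_0)}(a))+|\vec L_0|_\rho\cdot\gamma_\eta<v(P_{(\vec I)}(a))+|\vec I|_\rho\cdot\gamma_\eta.$$ (2) If $\rho$ is algebraic, then there is a pc-sequence $\{b_\eta\}$ in $K$, equivalent to $\{a_\eta\}$, such that $P(b_\eta)\leadsto P(a)$ for each non-constant $P\in\Sigma$; more precisely, for each such $P$ there is a unique $m_0=m_0(P)$ such that for all $\vec I$ with $|\vec I|\ge 1$ and $|\vec I|_\rho\neq m_0$, eventually in $\eta$, $$v(P(b_\eta)-P(a))=\min_{|\vec L_0|_\rho=m_0}\big(v(P_{(\vec L_0)}(a))+|\vec L_0|_\rho\cdot\gamma_\eta\big)<v(P_{(\vec I)}(a))+|\vec I|_\rho\cdot\gamma_\eta.$$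
   Context: A valued difference field $\mathcal K=(K,\Gamma,k;v,\pi)$ is a valued field (surjective valuation $v:K\to\Gamma\cup\{\infty\}$, valuation ring $\mathcal O$, residue map $\pi:\mathcal O\to k$) with a field automorphism $\sigma$ of $K$ satisfying $\sigma(\mathcal O)=\mathcal O$; $\sigma$ induces automorphisms $\sigma(v(x)):=v(\sigma(x))$ of $\Gamma$ and $\bar\sigma(\pi(x)):=\pi(\sigma(x))$ of $k$. It is a multiplicative valued difference field with parameter $\rho$ if $\mathrm{char}\,K=\mathrm{char}\,k=0$ and (Axiom 1), writing $\rho\cdot\gamma:=\sigma(\gamma)$ and $L\cdot\gamma:=\sum_i m_i\sigma^i(\gamma)$ for $L=\sum_i m_i\rho^i\in\mathbb Z[\rho]$: for each $L$, either $L\cdot\gamma>0$ for all $\gamma>0$, or $L\cdot\gamma=0$ for all $\gamma>0$, or $L\cdot\gamma<0$ for all $\gamma>0$; and $\rho\cdot\gamma\ge\gamma$ for all $\gamma>0$. So $v(\sigma(x))=\rho\cdot v(x)$. All extensions considered are again multiplicative valued difference fields with the same $\rho$. $\rho$ is algebraic if some nonzero $L\in\mathbb Z[\rho]$ satisfies $L\cdot\gamma=0$ for all $\gamma\in\Gamma$, and transcendental otherwise. Axiom 2: for each integer $d>0$ there is $y\in k$ with $\bar\sigma^d(y)\ne y$. A $\sigma$-polynomial over $K$ of order $\le n$ is $P(x)=F(\vec\sigma(x))$ with $F\in K[X_0,\dots,X_n]$ and $\vec\sigma(x)=(x,\sigma(x),\dots,\sigma^n(x))$; it is non-constant if $P\notin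 K$. For $\vec I=(i_0,\dots,i_n)$: $|\vec I|=\sum i_j$, $|\vec I|_\rho\cdot\gamma:=\sum_j i_j\rho^j\cdot\gamma$, $\vec y^{\vec I}=\prod y_j^{i_j}$. Taylor coefficients: if $F(\mathbf X+\mathbf Y)=\sum_{\vec I}F_{(\vec I)}(\mathbf X)\mathbf Y^{\vec I}$, set $P_{(\vec I)}(x):=F_{(\vec I)}(\vec\sigma(x))$, so $P(x+y)=\sum_{\vec I}P_{(\vec I)}(x)\vec\sigma(y)^{\vec I}$. A pc-sequence is a sequence $\{a_\eta\}_{\eta<\lambda}$ ($\lambda$ a limit ordinal) such that for some $\eta_0$, $\eta''>\eta'>\eta\ge\eta_0$ implies $v(a_{\eta''}-a_{\eta'})>v(a_{\eta'}-a_\eta)$; $a_\eta\leadsto a$ ($a$ is a pseudo-limit) means for some $\eta_0$, $\eta'>\eta\ge\eta_0$ implies $v(a-a_{\eta'})>v(a-a_\eta)$. Two pc-sequences are equivalent if they have the same pseudo-limits in all valued field extensions. *)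

(* Defs.v *)
From HB Require Import structures.
From mathcomp Require Import all_boot all_order all_algebra.
From mathcomp Require Export mpoly.

Set Implicit Arguments.
Unset Strict Implicit.
Unset Printing Implicit Defensive.

Import Order.TTheory GRing.Theory Num.Theory.
Local Open Scope ring_scope.

(** ** Ordered abelian groups *)

(* [porderZmodType] only joins an order and a group law: totality and
   translation invariance are added here. *)
Record orderedGroup := OrderedGroup {
  og_sort :> porderZmodType;
  og_total : total (<=%R : rel og_sort);
  og_leD2l : forall z x y : og_sort, x <= y -> z + x <= z + y
}.

(* The elements of G \cup {oo} are those of [option G], [None] being oo. *)
Section WithInfinity.
Variable G : orderedGroup.
Implicit Types x y : option G.

Definition vadd x y : option G :=
  match x, y with Some g, Some h => Some (g + h) | _, _ => None end.

Definition vle x y : bool :=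
  match x, y with
  | _, None => true
  | None, Some _ => false
  | Some g, Some h => g <= h
  end.

Definition vlt x y : bool :=
  match x, y with
  | None, _ => false
  | Some _, None => true
  | Some g, Some h => g < h
  end.

Definition vmin x y : option G := if vle x y then x else y.

(* [y] is the minimum of the [f t] with [S t]; it does not exist if [S] is
   empty. *)
Definition is_vmin (T : Type) (S : T -> Prop) (f : T -> option G) y : Prop :=
  (exists2 t, S t & f t = y) /\ (forall t, S t -> vle y (f t)).

End WithInfinity.

(** ** Valued fields and their extensions *)

(* The residue map is a total function [vf_pi], but only its restriction to the
   valuation ring is meaningful: it is a surjective ring morphism whose kernel
   is the maximal ideal. *)
Record valuedField := ValuedField {
  vf_sort :> fieldType;
  vf_group : orderedGroup;
  vf_residue : fieldType;
  vf_val : vf_sort -> option vf_group;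
  vf_pi : vf_sort -> vf_residue;
  vf_val_eq0 : forall x, vf_val x = None <-> x = 0;
  vf_valM : forall x y, vf_val (x * y) = vadd (vf_val x) (vf_val y);
  vf_valD : forall x y, vle (vmin (vf_val x) (vf_val y)) (vf_val (x + y));
  vf_val_surj : forall g, exists x, vf_val x = g;
  vf_pi1 : vf_pi 1 = 1;
  vf_piD : forall x y, vle (Some 0) (vf_val x) -> vle (Some 0) (vf_val y) ->
    vf_pi (x + y) = vf_pi x + vf_pi y;
  vf_piM : forall x y, vle (Some 0) (vf_val x) -> vle (Some 0) (vf_val y) ->
    vf_pi (x * y) = vf_pi x * vf_pi y;
  vf_pi_eq0 : forall x, vle (Some 0) (vf_val x) ->
    (vf_pi x = 0 <-> vlt (Some 0) (vf_val x));
  vf_pi_surj : forall y, exists2 x, vle (Some 0) (vf_val x) & vf_pi x = y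
}.

Definition val_ring (K : valuedField) : pred K :=
  fun x => vle (Some 0) (vf_val x).

(* The maps on value groups and residue fields are determined by the field
   embedding. *)
Record vfExt (K E : valuedField) := VfExt {
  ext_field :> {rmorphism K -> E};
  ext_group : {additive vf_group K -> vf_group E};
  ext_residue : {rmorphism vf_residue K -> vf_residue E};
  ext_group_mono : {mono ext_group : g h / g <= h};
  ext_val : forall x, vf_val (ext_field x) = omap ext_group (vf_val x);
  ext_pi : forall x, val_ring x -> vf_pi (ext_field x) = ext_residue (vf_pi x)
}.

(** ** Valued difference fields *)

(* [vd_sigma_group] and [vd_sigma_residue] are the maps induced by [vd_sigma];
   their defining equations determine them, as [vf_val] and [vf_pi] are
   surjective. *)
Record vdField := VdField {
  vd_vf :> valuedField;
  vd_sigma : {rmorphism vd_vf -> vd_vf};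
  vd_sigma_bij : bijective vd_sigma;
  vd_sigma_ring : forall y : vd_vf,
    val_ring y <-> exists2 x, val_ring x & vd_sigma x = y;
  vd_sigma_group : vf_group vd_vf -> vf_group vd_vf;
  vd_sigma_groupE : forall x,
    vf_val (vd_sigma x) = omap vd_sigma_group (vf_val x);
  vd_sigma_residue : vf_residue vd_vf -> vf_residue vd_vf;
  vd_sigma_residueE : forall x, val_ring x ->
    vf_pi (vd_sigma x) = vd_sigma_residue (vf_pi x)
}.

Record vdExt (K E : vdField) := VdExt {
  vdext_vf :> vfExt K E;
  vdext_sigma : forall x : K, vdext_vf (vd_sigma K x) = vd_sigma E (vdext_vf x)
}.

Section Multiplicative.
Variable K : vdField.
Local Notation G := (vf_group K).

(* [L : {poly int}] stands for an element of Z[rho], rho being the variable. *)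
Definition rho_act (L : {poly int}) (g : G) : G :=
  \sum_(i < size L) iter i (@vd_sigma_group K) g *~ L`_i.

Definition rho_pos (L : {poly int}) := forall g : G, 0 < g -> 0 < rho_act L g.
Definition rho_zero (L : {poly int}) := forall g : G, 0 < g -> rho_act L g = 0.
Definition rho_neg (L : {poly int}) := forall g : G, 0 < g -> rho_act L g < 0.

Definition axiom1 : Prop :=
  (forall L, rho_pos L \/ rho_zero L \/ rho_neg L) /\
  (forall g : G, 0 < g -> g <= vd_sigma_group g).

Definition multiplicative_vd : Prop :=
  [/\ [pchar K] =i pred0, [pchar (vf_residue K)] =i pred0 & axiom1].

Definition axiom2 : Prop :=
  forall d : nat, (0 < d)%N ->
    exists y : vf_residue K, iter d (@vd_sigma_residue K) y <> y.

Definition rho_algebraic : Prop :=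
  exists2 L : {poly int}, L != 0 & forall g : G, rho_act L g = 0.

Definition rho_transcendental : Prop := ~ rho_algebraic.

(* Equality in Z[rho], seen as a ring of operators on the value group. *)
Definition rho_eq (L M : {poly int}) : Prop :=
  forall g : G, rho_act L g = rho_act M g.

End Multiplicative.

(* [K] and [E] have the same rho: each element of Z[rho] has the same sign on
   the positive elements of both value groups. *)
Definition same_rho (K E : vdField) : Prop :=
  forall L : {poly int},
    [/\ rho_pos K L <-> rho_pos E L, rho_zero K L <-> rho_zero E L
      & rho_neg K L <-> rho_neg E L].

(** ** Sigma-polynomials *)

(* A sigma-polynomial P of order <= n over K is represented by the polynomial F
   in n+1 variables such that P(x) = F(x, sigma x, ..., sigma^n x). *)
Definition sigma_vec (K : vdField) n (x : K) : 'I_n.+1 -> K :=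
  fun j => iter j (vd_sigma K) x.

Definition sp_eval (K : vdField) n (F : {mpoly K[n.+1]}) (x : K) : K :=
  F.@[sigma_vec x].

Definition sp_map (K E : vdField) (e : vdExt K E) n (F : {mpoly K[n.+1]}) :
  {mpoly E[n.+1]} := map_mpoly e F.

Definition nonconstant (K : vdField) n (F : {mpoly K[n.+1]}) : Prop :=
  forall c : K, F <> c%:MP.

(* The coefficient of Y^m in F(X + Y), an element of R[X][Y]. *)
Definition taylor (R : comNzRingType) n (F : {mpoly R[n]}) (m : 'X_{1..n}) :
  {mpoly R[n]} :=
  (map_mpoly (@mpolyC n R) F \mPo
     [tuple ('X_i : {mpoly R[n]})%:MP + 'X_i | i < n])@_m.

(* |m|_rho, as an element of Z[rho]. *)
Definition rho_deg n (m : 'X_{1..n.+1}) : {poly int} :=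
  \sum_(j < n.+1) 'X^j *+ m j.

(** ** Pseudo-convergence *)

(* Up to isomorphism, the limit ordinals. *)
Definition limit_order d (I : orderType d) : Prop :=
  [/\ inhabited I, well_founded (fun i j : I => (i < j)%O)
    & forall i : I, exists j, (i < j)%O].

Definition eventually d (I : orderType d) (P : I -> Prop) : Prop :=
  exists i0, forall i, (i0 <= i)%O -> P i.

Section PseudoConvergence.
Variables (K : valuedField) (d : Order.disp_t) (I : orderType d).

Definition pc_sequence (a : I -> K) : Prop :=
  exists i0, forall i j k, (i0 <= i)%O -> (i < j)%O -> (j < k)%O ->
    vlt (vf_val (a j - a i)) (vf_val (a k - a j)).

Definition pseudo_limit (a : I -> K) (x : K) : Prop :=
  exists i0, forall i j, (i0 <= i)%O -> (i < j)%O ->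
    vlt (vf_val (x - a i)) (vf_val (x - a j)).

End PseudoConvergence.

(* The extensions are arbitrary valued fields, without an automorphism. *)
Definition pc_equivalent (K : valuedField) d (I : orderType d) (a b : I -> K) :
  Prop :=
  forall (E : valuedField) (e : vfExt K E) (x : E),
    pseudo_limit (fun i => e (a i)) x <-> pseudo_limit (fun i => e (b i)) x.

Definition exists_unique_mod (T : Type) (R : T -> T -> Prop) (Q : T -> Prop) :
  Prop :=
  exists x, Q x /\ forall y, Q y -> R x y.

(* Main.v *)
(* Write gamma_i = v(x - a_i). By Taylor expansion, P(c) - P(x) is the value at
   sigma(c - x) of a polynomial H without constant term whose coefficients are
   the P_(m)(x), and the m-th monomial has value the affine function
   v(P_(m)(x)) + |m|_rho . gamma_i of gamma_i.
   Two such functions with different slopes are eventually strictly comparable,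
   as their difference is strictly monotone by Axiom 1; so one term m0 is
   eventually minimal, and strictly smaller than all terms of a different slope.
   If rho is transcendental, all slopes are distinct: no cancellation can occur
   in P(a_i) - P(x).
   If rho is algebraic, the terms of minimal slope could cancel. For each i, pick
   theta in K of value gamma_i and replace a_i by b_i = a_i + mu theta with v(mu)
   >= 0: the value of P(b_i) - P(x) is the minimum of the values of the terms as
   soon as the residue of (b_i - x) / theta is not a zero of some nonzero
   sigma-polynomial over the residue field of E. As the powers of sigma are
   distinct on the residue field of K (Axiom 2), of characteristic 0, they are
   algebraically independent, and a suitable mu exists. *)

Require Import Defs.
From HB Require Import structures.
From mathcomp Require Import all_boot all_order all_algebra.
From mathcomp Require Import mpoly.
From Stdlib Require Import ClassicalEpsilon.

Set Implicit Arguments.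
Unset Strict Implicit.
Unset Printing Implicit Defensive.

Import Order.TTheory GRing.Theory Num.Theory.
Local Open Scope ring_scope.


(** * Multivariate polynomials *)

Section Shift.
Variable n : nat.

Definition shift_mpoly (R : comNzRingType) (c : 'I_n -> R) (F : {mpoly R[n]}) :
  {mpoly R[n]} := F \mPo [tuple 'X_i + (c i)%:MP | i < n].

Lemma shift_mpolyE (R : comNzRingType) (c v : 'I_n -> R) (F : {mpoly R[n]}) :
  (shift_mpoly c F).@[v] = F.@[fun i => v i + c i].
Proof.
rewrite /shift_mpoly comp_mpoly_meval; apply: meval_eq => i.
by rewrite tnth_mktuple mevalD mevalXU mevalC.
Qed.

Lemma shift_mpoly_comp (R : comNzRingType) (c : 'I_n -> R) (F : {mpoly R[n]}) :
  shift_mpoly (fun i => - c i) (shift_mpoly c F) = F.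
Proof.
rewrite [in RHS](mpolyE F) /shift_mpoly (comp_mpolyEX F) !raddf_sum /=.
apply: eq_bigr => m _; rewrite !comp_mpolyZ; congr (_ *: _).
rewrite comp_mpolyX rmorph_prod /= mpolyXE_id; apply: eq_bigr => i _.
rewrite rmorphXn /= tnth_mktuple comp_mpolyD comp_mpolyC comp_mpolyXU.
rewrite -tnth_nth tnth_mktuple.
by rewrite mpolyCN subrK.
Qed.

Lemma shift_mpoly_eqC (R : comNzRingType) (c : 'I_n -> R) (F : {mpoly R[n]}) b :
  shift_mpoly c F = b%:MP -> F = b%:MP.
Proof.
by move=> h; rewrite -(shift_mpoly_comp c F) h /shift_mpoly comp_mpolyC.
Qed.

Lemma mpoly_rmorph_eq (R S : nzRingType) (f g : {rmorphism {mpoly R[n]} -> S}) :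
  (forall c, f c%:MP = g c%:MP) -> (forall i, f 'X_i = g 'X_i) -> f =1 g.
Proof.
move=> fC fX; elim/mpolyind => [|c m p _ _ IH]; first by rewrite !rmorph0.
rewrite !rmorphD /= IH -mul_mpolyC !rmorphM /= fC; congr (_ * _ + _).
rewrite mpolyXE_id !rmorph_prod; apply: eq_bigr => i _.
by rewrite !rmorphXn /= fX.
Qed.

(** Both sides are the [m]-th coefficient of a ring morphism applied to [F], so comparing the
    morphisms on constants and variables suffices. Taylor coefficients at [c] can thus be read off
    F(Y + c). *)
Lemma taylor_meval (R S : comNzRingType) (f : {rmorphism R -> S}) (c : 'I_n -> S)
    (F : {mpoly R[n]}) (m : 'X_{1..n}) :
  (map_mpoly f (taylor F m)).@[c] = (shift_mpoly c (map_mpoly f F))@_m.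
Proof.
pose ev : {rmorphism {mpoly R[n]} -> S} := meval c \o map_mpoly f.
transitivity (map_mpoly ev (map_mpoly (@mpolyC n R) F \mPo
     [tuple ('X_i : {mpoly R[n]})%:MP + 'X_i | i < n]))@_m.
  by rewrite mcoeff_map_mpoly.
congr (_ @_ m); pose T1 := [tuple ('X_i : {mpoly R[n]})%:MP_[n] + 'X_i | i < n].
pose T2 := [tuple 'X_i + (c i)%:MP_[n] | i < n].
pose g1 : {rmorphism {mpoly R[n]} -> {mpoly S[n]}} :=
  map_mpoly ev \o (comp_mpoly T1 \o map_mpoly (@mpolyC n R)).
pose g2 : {rmorphism {mpoly R[n]} -> {mpoly S[n]}} :=
  comp_mpoly T2 \o map_mpoly f.
apply: (@mpoly_rmorph_eq _ _ g1 g2) => [b|i].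
  rewrite /g1 /g2 [LHS]/= [RHS]/= !map_mpolyC !comp_mpolyC map_mpolyC /=.
  by rewrite map_mpolyC mevalC.
rewrite /g1 /g2 [LHS]/= [RHS]/= !map_mpolyX !comp_mpolyXU -!tnth_nth !tnth_mktuple.
by rewrite raddfD /= map_mpolyC map_mpolyX /= map_mpolyX mevalXU addrC.
Qed.
End Shift.

Lemma meval_map_mpoly (R S : comNzRingType) n (f : {rmorphism R -> S})
    (v : 'I_n -> R) (F : {mpoly R[n]}) :
  (map_mpoly f F).@[f \o v] = f F.@[v].
Proof.
pose g1 : {rmorphism {mpoly R[n]} -> S} := meval (f \o v) \o map_mpoly f.
pose g2 : {rmorphism {mpoly R[n]} -> S} := f \o meval v.
apply: (@mpoly_rmorph_eq n _ _ g1 g2) => [c|i]; rewrite /g1 /g2 [LHS]/= [RHS]/=.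
  by rewrite map_mpolyC !mevalC.
by rewrite map_mpolyX !mevalXU.
Qed.

Lemma mnm_neq0_exists n (m : 'X_{1..n}) : m != 0%MM -> exists j, m j != 0%N.
Proof.
move=> m0; apply/existsP; rewrite -negb_forall; apply: contraNN m0 => /forallP h.
by apply/eqP/mnmP => j; rewrite mnm0E; apply/eqP.
Qed.

Lemma meval0_mcoeff (R : comNzRingType) n (F : {mpoly R[n]}) :
  F.@[fun=> 0] = F@_0%MM.
Proof.
elim/mpolyind: F => [|c m p _ _ IH]; first by rewrite meval0 mcoeff0.
rewrite mevalD mcoeffD IH mevalZ mcoeffZ mevalX mcoeffX; congr (_ * _ + _).
have [->|/mnm_neq0_exists[j mj]] := eqVneq m 0%MM.
  by apply: big1 => i _; rewrite mnm0E.
by rewrite (bigD1 j) //= expr0n (negPf mj) mul0r.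
Qed.

(** Both sides obey the Leibniz rule, so the identity passes from the variables to monomials, then
    by linearity to all polynomials. *)
Lemma mderiv_chain_rule n (R : comNzRingType) (y z : 'I_n -> R) (F : {mpoly R[n]}) :
  (mmap (@polyC R) (fun i => (y i)%:P + (z i) *: 'X) F)^`().[0]
  = \sum_i (mderiv i F).@[y] * z i.
Proof.
set h := fun i => _; pose T := mmap (@polyC R) h.
have T0 p : (T p).[0] = p.@[y].
  rewrite /T /mmap mevalE horner_sum; apply: eq_bigr => m _.
  rewrite hornerM hornerC; congr (_ * _).
  rewrite /mmap1 horner_prod; apply: eq_bigr => i _.
  by rewrite horner_exp !hornerE.
pose P p := (T p)^`().[0] = \sum_i (mderiv i p).@[y] * z i.
have PM p q : P p -> P q -> P (p * q).
  rewrite /P /T rmorphM /= derivM hornerD !hornerM -!/(T _) => -> ->.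
  rewrite !T0 mulr_suml mulr_sumr -big_split; apply: eq_bigr => i _ /=.
  by rewrite mderivM mevalD !mevalM mulrDl mulrAC mulrA.
have P1 : P 1.
  rewrite /P /T rmorph1 derivC horner0 big1 // => i _.
  by rewrite -mpolyC1 mderivC meval0 mul0r.
have PX i : P 'X_i.
  rewrite /P /T mmapX mmap1U /h derivD derivC derivZ derivX !hornerE.
  rewrite (bigD1 i) //= mderivX mnm1E eqxx scale1r mevalX.
  rewrite big1 => [|j _]; last by rewrite mnmBE subnn expr0.
  rewrite mul1r big1 ?addr0 // => j ji.
  by rewrite mderivX mnm1E eq_sym (negPf ji) scale0r meval0 mul0r.
have PXm (m : 'X_{1..n}) : P 'X_[m].
  rewrite mpolyXE_id; apply: (big_ind P) => // i _.
  by elim: (m i) => [|l IH]; rewrite ?expr0 // exprS; apply: PM.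
elim/mpolyind: F => [|c m p _ _ IH].
  rewrite rmorph0 deriv0 horner0 big1 // => i _; by rewrite mderiv0 meval0 mul0r.
rewrite rmorphD /= mmapZ derivD hornerD IH derivM derivC mul0r add0r hornerM.
rewrite hornerC -/(T _) PXm mulr_sumr -big_split; apply: eq_bigr => i _ /=.
by rewrite mderivD mderivZ mevalD mevalZ mulrDl mulrA.
Qed.

(** * Algebraic independence of distinct homomorphisms *)

Section Independence.
Variables (k k' : fieldType) (n : nat) (tau : 'I_n -> k -> k').
Hypothesis tau1 : forall i, tau i 1 = 1.
Hypothesis tauM : forall i, {morph tau i : y z / y * z}.
Hypothesis tau_neq : forall i j, i != j -> exists y, tau i y <> tau j y.

(** Dedekind's argument: the relation at [w * z] minus [tau j w] times the relation at [z] has no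
    [j]-th term. By induction its coefficients [c i * (tau i w - tau j w)] vanish, and [w] is chosen
    to separate [tau i] from [tau j]. The relation at 1 then kills [c j]. *)
Lemma characters_independent (s : seq 'I_n) (c : 'I_n -> k') : uniq s ->
  (forall z, \sum_(i <- s) c i * tau i z = 0) -> forall i, i \in s -> c i = 0.
Proof.
elim: s c => [|j s IH] c //= /andP[js us] h.
have cs i : i \in s -> c i = 0.
  move=> si; have ij : i != j by apply: contraNneq js => <-.
  have [w hw] := tau_neq ij.
  have /eqP : c i * (tau i w - tau j w) = 0.
    apply: (IH (fun i => c i * (tau i w - tau j w)) us _ i si) => z.
    have h1 := h (w * z); have := congr1 ( *%R (tau j w)) (h z).
    rewrite mulr0 -[RHS]h1 !big_cons mulrDr mulr_sumr tauM mulrCA.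
    move/addrI => h2; pose S := \sum_(l <- s) c l * tau l (w * z).
    transitivity (S - S); last exact: subrr.
    rewrite /S -[X in _ - X]h2 -sumrB; apply: eq_bigr => l _.
    by rewrite tauM mulrBr mulrBl mulrA [in RHS]mulrCA mulrA.
  rewrite mulf_eq0 subr_eq0; have /negPf-> : tau i w != tau j w by apply/eqP.
  by rewrite orbF => /eqP.
move=> i; rewrite inE => /predU1P[->|/cs//].
have := h 1; rewrite big_cons tau1 mulr1 big_seq big1 ?addr0 // => l /cs->.
by rewrite mul0r.
Qed.

Hypothesis tauD : forall i, {morph tau i : y z / y + z}.
Hypothesis char0 : [pchar k'] =i pred0.

(* If [F] vanishes at [tau y] for all [y], then [T |-> F (tau y + T tau z)]
   vanishes at all naturals, hence identically; its linear coefficient is a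
   relation between the characters [tau i], so all partial derivatives of [F]
   vanish on the image of [tau] and one concludes by induction on the degree. *)
Lemma homs_algebraically_independent (F : {mpoly k'[n]}) : F != 0 ->
  exists y, F.@[tau^~ y] != 0.
Proof.
have natr_inj (m l : nat) : m%:R = l%:R :> k' -> m = l.
  have nat0 p : p%:R = 0 :> k' -> p = 0%N.
    by move/eqP; rewrite ((pcharf0P k').1 char0) => /eqP.
  wlog ml : m l / (m <= l)%N => [H|].
    by case/orP: (leq_total m l) => ml h; [|symmetry]; apply: H.
  move=> h; apply/eqP; rewrite eqn_leq ml /= -subn_eq0; apply/eqP/nat0.
  by rewrite natrB // h subrr.
have tau0 i : tau i 0 = 0.
  by apply: (addrI (tau i 0)); rewrite -tauD !addr0.
have tauMn i l z : tau i (z *+ l) = l%:R * tau i z.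
  elim: l => [|l IH]; first by rewrite mulr0n mul0r tau0.
  by rewrite mulrS tauD IH -natr1 mulrDl mul1r addrC.
move=> F0; apply: NNPP => nex; move: F0; apply/negP; rewrite negbK.
have {nex} hF y : F.@[tau^~ y] = 0.
  by apply: NNPP => /eqP h; apply: nex; exists y.
have [N] := ubnP (msize F); elim: N F hF => // N IH F hF sF.
have hd j : mderiv j F = 0.
  apply/eqP; have [FC|FN] := leqP (msize F) 1.
    by rewrite (msize1_polyC FC) mderivC.
  apply: IH => [y|]; last first.
    rewrite (@leq_trans (msize F)) // -(prednK (ltnW FN)) ltnS msizeE.
    apply/bigmax_leqP_seq => m; rewrite mcoeff_msupp mcoeff_deriv => hm _.
    have : (m + U_(j))%MM \in msupp F.
      by rewrite mcoeff_msupp; apply: contraNneq hm => ->; rewrite mul0rn.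
    by move/msize_mdeg_lt; rewrite mdegD mdeg1 addn1; case: (msize F).
  apply: (@characters_independent (enum 'I_n) (fun i => (mderiv i F).@[tau^~ y])).
  - exact: enum_uniq.
  - move=> z; rewrite big_enum /= -mderiv_chain_rule.
    set q := mmap _ _ _.
    suff -> : q = 0 by rewrite deriv0 horner0.
    apply/eqP/negPn/negP => q0.
    (* The naturals below [size q], distinct in characteristic 0, are all roots: one more than the
       degree allows. *)
    have := max_poly_roots (rs := [seq i%:R | i <- iota 0 (size q)]) q0.
    rewrite size_map size_iota ltnn => H; apply/notF/H.
      apply/allP => _ /mapP[l _ ->]; rewrite /root; apply/eqP.
      rewrite -[RHS](hF (y + z *+ l)) /q mevalE /mmap horner_sum.
      apply: eq_bigr => m _; rewrite hornerM hornerC; congr (_ * _).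
      rewrite /mmap1 horner_prod; apply: eq_bigr => i _.
      by rewrite horner_exp !hornerE tauD tauMn mulrC.
    by rewrite map_inj_uniq ?iota_uniq // => u w /natr_inj.
  - by rewrite mem_enum.
have FC : F = (F@_0)%:MP.
  apply/mpolyP => m; rewrite mcoeffC; have [->|m0] := eqVneq m 0%MM.
    by rewrite mulr1.
  have [j mj] := mnm_neq0_exists m0.
  (* This coefficient of the derivative is [m j] times [F@_m], and [m j] is nonzero in
     characteristic 0. *)
  have := congr1 (fun G => G@_(m - U_(j))%MM) (hd j).
  rewrite mcoeff_deriv mcoeff0 submK; last first.
    by apply/mnm_lepP => i; rewrite mnm1E; case: eqP => // <-; rewrite lt0n.
  rewrite mulr0 => /eqP; rewrite -mulr_natr.
  by rewrite mulf_eq0 ((pcharf0P k').1 char0) /= orbF => /eqP.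
by have := hF 0; rewrite FC mevalC => ->; rewrite mpolyC0.
Qed.
End Independence.

(** * Ordered groups and valuations *)

Section OrderedGroup.
Variable G : orderedGroup.
Implicit Types (x y z : G) (g h k : option G).

Lemma og_leD2lE z x y : (z + x <= z + y) = (x <= y).
Proof.
apply/idP/idP => [h|]; last exact: og_leD2l.
by have := og_leD2l (- z) h; rewrite !addKr.
Qed.

Lemma og_ltD2lE z x y : (z + x < z + y) = (x < y).
Proof. by rewrite !lt_neqAle og_leD2lE (inj_eq (addrI z)). Qed.

Lemma og_ltNge x y : (x < y) = ~~ (y <= x).
Proof. by rewrite comparable_ltNge //; apply: og_total. Qed.

Lemma og_leD x y z t : x <= y -> z <= t -> x + z <= y + t.
Proof.
by move=> xy zt; apply: (le_trans (og_leD2l x zt)); rewrite ![_ + t]addrC og_leD2lE.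
Qed.

Lemma og_ltD x y z t : x < y -> z <= t -> x + z < y + t.
Proof.
move=> xy zt; apply: (le_lt_trans (og_leD2l x zt)).
by rewrite ![_ + t]addrC og_ltD2lE.
Qed.

Lemma og_addr_gt0 x y : 0 < x -> 0 <= y -> 0 < x + y.
Proof. by move=> x0 y0; rewrite -[0]addr0 og_ltD. Qed.

Lemma og_subr_gt0 x y : (0 < y - x) = (x < y).
Proof. by rewrite -(og_ltD2lE x 0) addr0 addrC subrK. Qed.

Lemma og_subr_ge0 x y : (0 <= y - x) = (x <= y).
Proof. by rewrite -(og_leD2lE x 0) addr0 addrC subrK. Qed.

(** A total invariant order excludes 2-torsion; this yields v(-1) = 0. *)
Lemma og_double_eq0 x : x + x = 0 -> x = 0.
Proof.
move=> h; apply/eqP; apply/negP => /negP x0.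
case/orP: (og_total x 0) => hx.
  have /(og_ltD)/(_ hx) : x < 0 by rewrite lt_neqAle x0.
  by rewrite h addr0 ltxx.
have hx0 : 0 < x by rewrite lt_neqAle eq_sym x0.
by have := og_ltD hx0 hx; rewrite h addr0 ltxx.
Qed.

Lemma og_mulrn_ge0 x m : 0 <= x -> 0 <= x *+ m.
Proof.
move=> x0; elim: m => [|m IH]; first by rewrite mulr0n.
by rewrite mulrS -[0]addr0 og_leD.
Qed.

Lemma og_mulrn_gt0 x m : (0 < m)%N -> 0 < x -> 0 < x *+ m.
Proof.
case: m => // m _ x0; rewrite mulrS -[0]addr0 og_ltD // og_mulrn_ge0 //.
exact: ltW.
Qed.

Lemma og_sumr_ge0 (T : Type) (r : seq T) (P : pred T) (F : T -> G) :
  (forall i, P i -> 0 <= F i) -> 0 <= \sum_(i <- r | P i) F i.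
Proof.
by move=> h; elim/big_ind: _ => // x y x0 y0; rewrite -[0]addr0 og_leD.
Qed.

Lemma vle_refl g : vle g g. Proof. by case: g => //= x. Qed.

Lemma vle_None g : vle g None. Proof. by case: g. Qed.

Lemma vltNge g h : vlt g h = ~~ vle h g.
Proof. by case: g h => [x|] [y|] //=; rewrite og_ltNge. Qed.

Lemma vle_total g h : vle g h || vle h g.
Proof. by case: g h => [x|] [y|] //=; apply: og_total. Qed.

Lemma vle_trans h g k : vle g h -> vle h k -> vle g k.
Proof. by case: g h k => [x|] [y|] [z|] //=; apply: le_trans. Qed.

Lemma vle_anti g h : vle g h -> vle h g -> g = h.
Proof.
case: g h => [x|] [y|] //= xy yx; congr Some; apply/eqP.
by rewrite eq_le xy yx.
Qed.

Lemma vltW g h : vlt g h -> vle g h.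
Proof. by case: g h => [x|] [y|] //=; apply: ltW. Qed.

Lemma vlt_irr g : vlt g g = false.
Proof. by rewrite vltNge vle_refl. Qed.

Lemma vlt_le_trans h g k : vlt g h -> vle h k -> vlt g k.
Proof. by case: g h k => [x|] [y|] [z|] //=; apply: lt_le_trans. Qed.

Lemma vle_vmin g h k : vle g (vmin h k) = vle g h && vle g k.
Proof.
rewrite /vmin; case: ifP => [hk|/negbT].
  by apply/idP/andP => [gh|[]//]; split=> //; apply: vle_trans hk.
rewrite -vltNge => /vltW kh.
by apply/idP/andP => [gk|[]//]; split=> //; apply: vle_trans kh.
Qed.

Lemma vaddC g h : vadd g h = vadd h g.
Proof. by case: g h => [x|] [y|] //=; rewrite addrC. Qed.

Lemma vadd0 g : vadd (Some 0) g = g.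
Proof. by case: g => //= x; rewrite add0r. Qed.

End OrderedGroup.

(** * Ultrametric computations and residues *)

Section Valuation.
Variable K : valuedField.
Local Notation v := (@vf_val K).
Implicit Types x y : K.

Lemma val0 : v 0 = None. Proof. exact/vf_val_eq0. Qed.

Lemma val_neq0 x : x != 0 -> exists g, v x = Some g.
Proof.
case E: (v x) => [g|] h; first by exists g.
by move: h; rewrite (vf_val_eq0 x).1 ?eqxx.
Qed.

Lemma val_Some_neq0 x g : v x = Some g -> x != 0.
Proof. by move=> h; apply/eqP => x0; move: h; rewrite x0 val0. Qed.

Lemma val1 : v 1 = Some 0.
Proof.
have [g hg] := val_neq0 (oner_neq0 K).
have := vf_valM (1 : K) 1; rewrite mulr1 hg /= => -[].
by move/(congr1 (fun z => z - g)); rewrite addrK subrr => <-.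
Qed.

Lemma valN x : v (- x) = v x.
Proof.
rewrite -mulN1r vf_valM; have N1 : (- 1 : K) != 0 by rewrite oppr_eq0 oner_eq0.
have [g hg] := val_neq0 N1.
have := vf_valM (- 1 : K) (- 1); rewrite mulrNN mulr1 val1 hg /= => -[] /esym.
by move/og_double_eq0 => ->; case: (v x) => // h; rewrite add0r.
Qed.

Lemma valBC x y : v (x - y) = v (y - x).
Proof. by rewrite -valN opprB. Qed.

Lemma val_geD g x y : vle g (v x) -> vle g (v y) -> vle g (v (x + y)).
Proof.
by move=> gx gy; apply: vle_trans (vf_valD x y); rewrite vle_vmin gx.
Qed.

Lemma val_ltD x y : vlt (v x) (v y) -> v (x + y) = v x.
Proof.
move=> xy; apply: vle_anti; last by apply: val_geD (vle_refl _) (vltW xy).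
have := vf_valD (x + y) (- y); rewrite addrK valN /vmin.
by case: ifP => // _ yx; have := vlt_le_trans xy yx; rewrite vlt_irr.
Qed.

Lemma val_prod (T : Type) (r : seq T) (F : T -> K) (g : T -> vf_group K) :
  (forall i, v (F i) = Some (g i)) -> v (\prod_(i <- r) F i) = Some (\sum_(i <- r) g i).
Proof.
move=> h; elim: r => [|i r IH]; first by rewrite !big_nil val1.
by rewrite !big_cons vf_valM h IH.
Qed.

Lemma valX x m g : v x = Some g -> v (x ^+ m) = Some (g *+ m).
Proof.
move=> h; elim: m => [|m IH]; first by rewrite expr0 mulr0n val1.
by rewrite exprS vf_valM h IH mulrS.
Qed.

Lemma valV x g : v x = Some g -> v x^-1 = Some (- g).
Proof.
move=> h; have x0 := val_Some_neq0 h.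
have := vf_valM x x^-1; rewrite mulfV // val1 h.
by case: (v _) => //= k [] /esym/eqP; rewrite addrC addr_eq0 => /eqP ->.
Qed.

Lemma val_ring0 : val_ring (0 : K). Proof. by rewrite /val_ring val0. Qed.

Lemma val_ring1 : val_ring (1 : K). Proof. by rewrite /val_ring val1 vle_refl. Qed.

Lemma val_ringD x y : val_ring x -> val_ring y -> val_ring (x + y).
Proof. exact: val_geD. Qed.

Lemma val_ringM x y : val_ring x -> val_ring y -> val_ring (x * y).
Proof.
rewrite /val_ring vf_valM; case: (v x) (v y) => [g|] [h|] //= g0 h0.
by rewrite -[0]addr0 og_leD.
Qed.

Lemma val_ringX x m : val_ring x -> val_ring (x ^+ m).
Proof.
move=> h; elim: m => [|m IH]; first exact: val_ring1.
by rewrite exprS; apply: val_ringM.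
Qed.

Lemma vf_pi0 : vf_pi (0 : K) = 0.
Proof. by apply/(vf_pi_eq0 val_ring0); rewrite val0. Qed.

Lemma vf_piX x m : val_ring x -> vf_pi (x ^+ m) = vf_pi x ^+ m.
Proof.
move=> h; elim: m => [|m IH]; first exact: vf_pi1.
by rewrite !exprS vf_piM ?IH //; apply: val_ringX.
Qed.

Lemma vf_pi_prod (T : Type) (r : seq T) (F : T -> K) :
  (forall i, val_ring (F i)) ->
  val_ring (\prod_(i <- r) F i) /\
  vf_pi (\prod_(i <- r) F i) = \prod_(i <- r) vf_pi (F i).
Proof.
move=> h; elim: r => [|i r [IH1 IH2]].
  by rewrite !big_nil; split; [exact: val_ring1 | exact: vf_pi1].
rewrite !big_cons; split; first exact: val_ringM.
by rewrite vf_piM ?IH2 //; apply: h.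
Qed.

Lemma vf_pi_sum (T : eqType) (r : seq T) (F : T -> K) :
  (forall i, i \in r -> val_ring (F i)) ->
  val_ring (\sum_(i <- r) F i) /\
  vf_pi (\sum_(i <- r) F i) = \sum_(i <- r) vf_pi (F i).
Proof.
elim: r => [|i r IH] h.
  by rewrite !big_nil; split; [exact: val_ring0 | exact: vf_pi0].
have hi : val_ring (F i) by apply: h; rewrite mem_head.
have [IH1 IH2] : val_ring (\sum_(i <- r) F i) /\
  vf_pi (\sum_(i <- r) F i) = \sum_(i <- r) vf_pi (F i).
  by apply: IH => j jr; apply: h; rewrite in_cons jr orbT.
rewrite !big_cons; split; first exact: val_ringD.
by rewrite vf_piD // IH2.
Qed.

Lemma vf_pi_neq0 x : val_ring x -> vf_pi x != 0 -> v x = Some 0.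
Proof.
move=> hx px; apply: vle_anti; last exact: hx.
rewrite -[vle _ _]negbK -vltNge; apply: contra px => h.
by apply/eqP/vf_pi_eq0.
Qed.
End Valuation.

(** * The action of sigma and of Z[rho] on the value group and residue field *)

Section DifferenceField.
Variable K : vdField.
Local Notation v := (@vf_val K).
Local Notation sg := (@vd_sigma_group K).
Local Notation sr := (@vd_sigma_residue K).
Local Notation G := (vf_group K).

Lemma val_iter_sigma j (x : K) : v (iter j (vd_sigma K) x) = omap (iter j sg) (v x).
Proof.
by elim: j => [|j IH] /=; rewrite ?vd_sigma_groupE ?IH; case: (v x).
Qed.

Lemma val_ring_sigma j (x : K) : val_ring x -> val_ring (iter j (vd_sigma K) x).
Proof.
by move=> hx; elim: j => //= j IH; apply/vd_sigma_ring; exists (iter j (vd_sigma K) x).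
Qed.

Lemma vf_pi_iter_sigma j (x : K) : val_ring x ->
  vf_pi (iter j (vd_sigma K) x) = iter j sr (vf_pi x).
Proof.
move=> hx; elim: j => //= j <-; apply: vd_sigma_residueE.
exact: val_ring_sigma.
Qed.

Lemma iter_sigmaD j (x y : K) :
  iter j (vd_sigma K) (x + y) = iter j (vd_sigma K) x + iter j (vd_sigma K) y.
Proof. by elim: j => //= j ->; rewrite rmorphD. Qed.

Lemma iter_sigmaB j (x y : K) :
  iter j (vd_sigma K) (x - y) = iter j (vd_sigma K) x - iter j (vd_sigma K) y.
Proof. by elim: j => //= j ->; rewrite rmorphB. Qed.

Lemma iter_sigmaM j (x y : K) :
  iter j (vd_sigma K) (x * y) = iter j (vd_sigma K) x * iter j (vd_sigma K) y.
Proof. by elim: j => //= j ->; rewrite rmorphM. Qed.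

Lemma sigma_groupD : {morph sg : g h / g + h}.
Proof.
move=> g h; have [x hx] := vf_val_surj (Some g); have [y hy] := vf_val_surj (Some h).
have := vd_sigma_groupE (x * y); rewrite rmorphM !vf_valM !vd_sigma_groupE hx hy /=.
by case.
Qed.

Lemma iter_sigma_groupD j : {morph iter j sg : g h / g + h}.
Proof. by move=> g h; elim: j => //= j ->; rewrite sigma_groupD. Qed.

Lemma rho_actD (L : {poly int}) : {morph rho_act (K := K) L : g h / g + h}.
Proof.
move=> g h; rewrite /rho_act -big_split; apply: eq_bigr => i _ /=.
by rewrite iter_sigma_groupD mulrzDl.
Qed.

Lemma rho_act0r (L : {poly int}) : rho_act (K := K) L 0 = 0.
Proof. by apply: (addrI (rho_act L 0)); rewrite -rho_actD !addr0. Qed.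

Lemma rho_actN (L : {poly int}) (g : G) : rho_act L (- g) = - rho_act L g.
Proof.
by apply/eqP; rewrite -addr_eq0 -rho_actD addNr rho_act0r.
Qed.

Lemma rho_actB (L : {poly int}) (g h : G) :
  rho_act L (g - h) = rho_act L g - rho_act L h.
Proof. by rewrite rho_actD rho_actN. Qed.

Lemma rho_act_widen N (L : {poly int}) (g : G) : (size L <= N)%N ->
  rho_act L g = \sum_(i < N) iter i sg g *~ L`_i.
Proof.
move=> sN; rewrite /rho_act (big_ord_widen N (fun i => iter i sg g *~ L`_i)) //.
rewrite big_mkcond; apply: eq_bigr => i _; case: ltnP => // si.
by rewrite nth_default // mulr0z.
Qed.

Lemma rho_actBl (L M : {poly int}) (g : G) :
  rho_act (L - M) g = rho_act L g - rho_act M g.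
Proof.
pose N := maxn (size L) (size M).
rewrite !(@rho_act_widen N) ?leq_maxl ?leq_maxr //; last first.
  by rewrite (leq_trans (size_polyD _ _)) // size_polyN.
by rewrite -sumrB; apply: eq_bigr => i _; rewrite coefB mulrzBr.
Qed.

Lemma rho_deg_coef n (m : 'X_{1..n.+1}) (j : 'I_n.+1) : (rho_deg m)`_j = (m j)%:Z.
Proof.
rewrite /rho_deg coef_sum (bigD1 j) //= coefMn coefXn eqxx big1 ?addr0 ?natz //.
move=> i ij; rewrite coefMn coefXn eq_sym; have /negPf -> // : (i : nat) != j by [].
exact: mul0rn.
Qed.

Lemma size_rho_deg n (m : 'X_{1..n.+1}) : (size (rho_deg m) <= n.+1)%N.
Proof.
apply: (leq_trans (size_sum _ _ _)); apply/bigmax_leqP => j _.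
by rewrite -scaler_nat (leq_trans (size_scale_leq _ _)) // size_polyXn.
Qed.

Lemma rho_deg_inj n : injective (@rho_deg n).
Proof.
move=> m1 m2 h; apply/mnmP => j; have := rho_deg_coef m1 j.
by rewrite h rho_deg_coef => -[].
Qed.

Lemma rho_act_deg n (m : 'X_{1..n.+1}) (g : G) :
  rho_act (rho_deg m) g = \sum_(j < n.+1) iter j sg g *+ m j.
Proof.
rewrite (rho_act_widen _ (size_rho_deg m)); apply: eq_bigr => j _.
by rewrite rho_deg_coef.
Qed.

Lemma val_sigma_monomial n (m : 'X_{1..n.+1}) (y : K) g : v y = Some g ->
  v (\prod_(j < n.+1) sigma_vec y j ^+ m j) = Some (rho_act (rho_deg m) g).
Proof.
move=> hy; rewrite rho_act_deg; apply: val_prod => j.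
by apply: valX; rewrite /sigma_vec val_iter_sigma hy.
Qed.

Hypothesis ax1 : axiom1 K.

Lemma iter_sigma_group_gt0 j (g : G) : 0 < g -> 0 < iter j sg g.
Proof. by move=> g0; elim: j => //= j IH; apply: (lt_le_trans IH); apply: ax1.2. Qed.

Lemma rho_act_deg_gt0 n (m : 'X_{1..n.+1}) (g : G) : m != 0%MM -> 0 < g ->
  0 < rho_act (rho_deg m) g.
Proof.
move=> m0 g0; rewrite rho_act_deg.
have [j mj] := mnm_neq0_exists m0.
rewrite (bigD1 j) //= og_addr_gt0 //.
  by apply: og_mulrn_gt0; rewrite ?lt0n ?iter_sigma_group_gt0.
apply: og_sumr_ge0 => i _; apply: og_mulrn_ge0; apply: ltW.
exact: iter_sigma_group_gt0.
Qed.

(** Positive elements suffice because the action is additive and the order total. This links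
    [rho_zero] with the quantification over the whole group in [rho_algebraic] and [rho_eq]. *)
Lemma rho_zero_act (L : {poly int}) : rho_zero K L <-> forall g : G, rho_act L g = 0.
Proof.
split=> h g // ; have [->|g0] := eqVneq g 0; first exact: rho_act0r.
case/orP: (og_total g 0) => hg; last by apply: h; rewrite lt_neqAle eq_sym g0.
have /h/eqP : 0 < - g.
  by rewrite -sub0r og_subr_gt0 lt_neqAle g0.
by rewrite rho_actN oppr_eq0 => /eqP.
Qed.

Lemma rho_eq_zero (L M : {poly int}) : rho_eq K L M <-> rho_zero K (L - M).
Proof.
rewrite rho_zero_act; split=> h g; first by rewrite rho_actBl h subrr.
by apply/eqP; rewrite -subr_eq0 -rho_actBl h.
Qed.

Lemma sigma_residue1 : sr 1 = 1.
Proof. by rewrite -(vf_pi1 K) -vd_sigma_residueE ?rmorph1 //; apply: val_ring1. Qed.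

Lemma sigma_residueD : {morph sr : y z / y + z}.
Proof.
move=> y z; have [y' hy <-] := vf_pi_surj y; have [z' hz <-] := vf_pi_surj z.
have sy := val_ring_sigma 1 hy; have sz := val_ring_sigma 1 hz.
rewrite -!vd_sigma_residueE // -!vf_piD // -vd_sigma_residueE ?rmorphD //.
exact: val_ringD.
Qed.

Lemma sigma_residueM : {morph sr : y z / y * z}.
Proof.
move=> y z; have [y' hy <-] := vf_pi_surj y; have [z' hz <-] := vf_pi_surj z.
have sy := val_ring_sigma 1 hy; have sz := val_ring_sigma 1 hz.
rewrite -!vd_sigma_residueE // -!vf_piM // -vd_sigma_residueE ?rmorphM //.
exact: val_ringM.
Qed.

Lemma iter_sigma_residue1 j : iter j sr 1 = 1.
Proof. by elim: j => //= j ->; apply: sigma_residue1. Qed.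

Lemma iter_sigma_residueD j : {morph iter j sr : y z / y + z}.
Proof. by move=> y z; elim: j => //= j ->; apply: sigma_residueD. Qed.

Lemma iter_sigma_residueM j : {morph iter j sr : y z / y * z}.
Proof. by move=> y z; elim: j => //= j ->; apply: sigma_residueM. Qed.

Lemma iter_sigma_residue_inj j : injective (iter j sr).
Proof.
have inj y : y != 0 -> iter j sr y != 0.
  move=> y0; apply/eqP => h.
  have := iter_sigma_residueM j y y^-1; rewrite mulfV // iter_sigma_residue1 h.
  by rewrite mul0r => /eqP; rewrite oner_eq0.
move=> y z yz; apply/eqP; rewrite -subr_eq0; apply/negPn/negP => /inj/negP; apply.
have := iter_sigma_residueD j (y - z) z; rewrite subrK yz => /eqP.
by rewrite -subr_eq subrr eq_sym.
Qed.

(** For [i < j], Axiom 2 with exponent [j - i] moves some [y], and the injective [i]-th iterate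
    keeps the two values apart. *)
Lemma iter_sigma_residue_neq (ax2 : axiom2 K) i j : i != j ->
  exists y, iter i sr y <> iter j sr y.
Proof.
wlog ij : i j / (i < j)%N => [H|_].
  case: (ltngtP i j) => // [ij|ji] _.
    by apply: (H _ _ ij); rewrite ltn_eqF.
  have [|y hy] := H _ _ ji; first by rewrite ltn_eqF.
  by exists y => /esym.
have [|y hy] := ax2 (j - i)%N; first by rewrite subn_gt0.
exists y => h; apply: hy; apply: (@iter_sigma_residue_inj i).
by rewrite -iterD subnKC // ltnW.
Qed.
End DifferenceField.

(** The bound is taken finite because the empty sum has value oo, which [vlt] does not place above
    itself. *)
Lemma val_gt_sum (K : valuedField) g (T : Type) (r : seq T) (P : pred T) (F : T -> K) :
  (forall i, P i -> vlt (Some g) (vf_val (F i))) ->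
  vlt (Some g) (vf_val (\sum_(i <- r | P i) F i)).
Proof.
move=> h; elim/big_ind: _ => // [|y z hy hz]; first by rewrite val0.
rewrite vltNge; apply/negP => h1.
case/orP: (vle_total (vf_val y) (vf_val z)) => h2.
  have := val_geD (vle_refl (vf_val y)) h2 => h3.
  by have := vlt_le_trans hy (vle_trans h3 h1); rewrite vlt_irr.
have := val_geD h2 (vle_refl (vf_val z)) => h3.
by have := vlt_le_trans hz (vle_trans h3 h1); rewrite vlt_irr.
Qed.

(** Stated for a relation in [Prop], so as to serve both for the order on values and for the
    eventual order along the sequence. *)
Lemma seq_min_exists (T : eqType) (R : T -> T -> Prop) (s : seq T) :
  (forall x y, x \in s -> y \in s -> R x y \/ R y x) ->
  (forall y x z, R x y -> R y z -> R x z) -> s != [::] ->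
  exists2 x, x \in s & forall y, y \in s -> R x y.
Proof.
move=> Rtot Rtr; elim: s Rtot => // x s IH Rtot _.
have Rxx : R x x by case: (Rtot x x); rewrite ?mem_head.
have [->|s0] := eqVneq s [::].
  by exists x; rewrite ?mem_head // => y; rewrite inE => /eqP ->.
have [|y ys hy] := IH _ s0.
  by move=> u w us ws; apply: Rtot; rewrite inE ?us ?ws orbT.
case: (Rtot x y); rewrite ?mem_head ?inE ?ys ?orbT // => h.
  exists x; rewrite ?mem_head // => z; rewrite inE => /predU1P[->//|/hy].
  exact: Rtr.
exists y; first by rewrite inE ys orbT.
by move=> z; rewrite inE => /predU1P[->//|/hy].
Qed.

(** * Values of monomials and absence of cancellation *)

Section Terms.
Variables (E : vdField) (n : nat).
Local Notation v := (@vf_val E).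
Implicit Types (H : {mpoly E[n.+1]}) (m : 'X_{1..n.+1}).

(** For finite [g], this is the value of the [m]-th monomial of [H] at [sigma_vec y] with v(y) =
    [g]: an affine function of slope |m|_rho, or oo if the coefficient vanishes. *)
Definition term_val H m (g : option (vf_group E)) : option (vf_group E) :=
  vadd (v H@_m) (omap (rho_act (rho_deg m)) g).

(** Expresses that the terms of least value do not cancel, several of them being allowed. *)
Definition attains_min_term H (y : E) (g : option (vf_group E)) : Prop :=
  exists2 m, m \in msupp H & v H.@[sigma_vec y] = term_val H m g /\
    forall m', m' \in msupp H -> vle (term_val H m g) (term_val H m' g).

Lemma term_val_None H m g : m \notin msupp H -> term_val H m g = None.
Proof. by rewrite -mcoeff_eq0 /term_val => /eqP ->; rewrite val0. Qed.

Lemma term_val_Some H m g : m \in msupp H ->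
  exists t, term_val H m (Some g) = Some (t + rho_act (rho_deg m) g).
Proof.
by rewrite mcoeff_msupp => /val_neq0[t ht]; exists t; rewrite /term_val ht.
Qed.

Lemma val_monomial H m (y : E) g : v y = Some g ->
  v (H@_m * \prod_(j < n.+1) sigma_vec y j ^+ m j) = term_val H m (Some g).
Proof. by move=> hy; rewrite vf_valM (val_sigma_monomial m hy). Qed.

(** The ultrametric inequality is an equality when one term is strictly smallest. This settles the
    transcendental case, where the sequence [a] itself is kept. *)
Lemma val_strict_min H m0 (y : E) g : v y = Some g -> m0 \in msupp H ->
  (forall m, m \in msupp H -> m != m0 ->
     vlt (term_val H m0 (Some g)) (term_val H m (Some g))) ->
  v H.@[sigma_vec y] = term_val H m0 (Some g).
Proof.
move=> hy m0H hm; rewrite mevalE (bigD1_seq m0) //= -(val_monomial H m0 hy).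
apply: val_ltD; rewrite (val_monomial H m0 hy).
have [t ht] := term_val_Some g m0H; rewrite ht big_seq_cond.
by apply: val_gt_sum => m /andP[mH mm0]; rewrite (val_monomial H m hy) -ht hm.
Qed.

(* Divide [H (sigma (theta * d))] by the smallest of the coefficients
   [H@_m * sigma(theta)^m] and reduce: the residue polynomial [R] has a
   coefficient 1, and no grouping by [rho_deg m] is needed. *)
Lemma residual_polynomial H (theta : E) g : H != 0 -> v theta = Some g ->
  exists2 R : {mpoly (vf_residue E)[n.+1]}, R != 0 &
    forall d : E, val_ring d -> R.@[fun j => vf_pi (sigma_vec d j)] != 0 ->
      attains_min_term H (theta * d) (Some g).
Proof.
move=> H0 hth.
have [|||m0 m0H hmin] := @seq_min_exists _
    (fun m m' => vle (term_val H m (Some g)) (term_val H m' (Some g))) (msupp H).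
- by move=> m m' _ _; apply/orP/vle_total.
- by move=> m2 m1 m3; apply: vle_trans.
- by rewrite msupp_eq0.
(* [w m] is the [m]-th coefficient of [H] at sigma(theta d), seen as a polynomial in sigma(d). *)
pose w m := H@_m * \prod_(j < n.+1) sigma_vec theta j ^+ m j.
have hw m : v (w m) = term_val H m (Some g) by apply: val_monomial.
have [t0 ht0] := term_val_Some g m0H; rewrite -hw in ht0.
have w0 : w m0 != 0 := val_Some_neq0 ht0.
pose r m := w m / w m0.
have hr m : m \in msupp H -> val_ring (r m).
  move=> mH; rewrite /val_ring /r vf_valM (valV ht0).
  have := hmin _ mH; rewrite -!hw ht0; case: (v (w m)) => //= u.
  by rewrite og_subr_ge0.
pose R := \sum_(m <- msupp H) vf_pi (r m) *: 'X_[m] : {mpoly (vf_residue E)[n.+1]}.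
exists R.
  apply/eqP => /(congr1 (fun p => p@_m0)); rewrite mcoeff0 /R raddf_sum /=.
  rewrite (bigD1_seq m0) //= mcoeffZ mcoeffX eqxx mulr1 big1 => [|m mm0].
    by rewrite addr0 /r mulfV // vf_pi1 => /eqP; rewrite oner_eq0.
  by rewrite mcoeffZ mcoeffX (negPf mm0) mulr0.
move=> d hd hR; exists m0 => //; split=> //.
pose u m := r m * \prod_(j < n.+1) sigma_vec d j ^+ m j.
have hp m := @vf_pi_prod E _ (index_enum 'I_n.+1) (fun j => sigma_vec d j ^+ m j)
  (fun j => val_ringX (m j) (val_ring_sigma j hd)).
have [|su pu] := @vf_pi_sum E _ (msupp H) u.
  by move=> m mH; apply: val_ringM (hr _ mH) (hp m).1.
have -> : H.@[sigma_vec (theta * d)] = w m0 * \sum_(m <- msupp H) u m.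
  rewrite mevalE mulr_sumr; apply: eq_bigr => m _.
  rewrite /u /r mulrA [w m0 * _]mulrC divfK // /w -mulrA -big_split /=.
  congr (_ * _); apply: eq_bigr => j _.
  by rewrite /sigma_vec iter_sigmaM exprMn.
(* The normalised sum has nonzero residue, hence value 0, and only the value of [w m0] remains. *)
rewrite vf_valM hw vf_pi_neq0 //; first by rewrite vaddC vadd0.
suff -> : vf_pi (\sum_(m <- msupp H) u m) = R.@[fun j => vf_pi (sigma_vec d j)] by [].
rewrite pu /R raddf_sum big_seq [RHS]big_seq /=; apply: eq_bigr => m mH.
rewrite mevalZ mevalX /u vf_piM; [|exact: hr|exact: (hp m).1].
rewrite [X in _ * X](hp m).2; congr (_ * _).
by apply: eq_bigr => j _; rewrite vf_piX //; apply: val_ring_sigma.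
Qed.

(** The product of the residual polynomials handles all of [Hs] at once; the extra factor ['X_ord0]
    makes the residue of [d] nonzero, so that v(d) = 0. *)
Lemma residual_polynomials (Hs : seq {mpoly E[n.+1]}) (theta : E) g :
  {in Hs, forall H, H != 0} -> v theta = Some g ->
  exists2 R : {mpoly (vf_residue E)[n.+1]}, R != 0 &
    forall d : E, val_ring d -> R.@[fun j => vf_pi (sigma_vec d j)] != 0 ->
      v d = Some 0 /\ {in Hs, forall H, attains_min_term H (theta * d) (Some g)}.
Proof.
move=> Hs0 hth; elim: Hs Hs0 => [|H Hs IH] Hs0.
  exists 'X_ord0; first by rewrite -msupp_eq0 msuppX.
  by move=> d hd; rewrite mevalXU => pd; split=> //; apply: vf_pi_neq0.
have [|R1 R10 hR1] := IH; first by move=> H' hH'; apply: Hs0; rewrite inE hH' orbT.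
have [R2 R20 hR2] := residual_polynomial (Hs0 H (mem_head _ _)) hth.
exists (R1 * R2); first by rewrite mulf_neq0.
move=> d hd; rewrite mevalM mulf_eq0 negb_or.
move=> /andP[/(hR1 _ hd)[vd h1] /(hR2 _ hd) h2].
by split=> // H'; rewrite inE => /predU1P[->//|/h1].
Qed.
End Terms.

(** * Generic elements of the small field, from Axiom 2 *)

Section Extension.

Lemma ext_val_inj (K E : valuedField) (e : vfExt K E) (x y : K) :
  vf_val (e x) = vf_val (e y) <-> vf_val x = vf_val y.
Proof.
rewrite !ext_val; split=> [|->//].
case: (vf_val x) (vf_val y) => [g|] [h|] //= [] gh; congr Some.
by apply/eqP; rewrite eq_le -!(ext_group_mono e) gh lexx.
Qed.

Lemma ext_val_ring (K E : valuedField) (e : vfExt K E) (x : K) :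
  val_ring x -> val_ring (e x).
Proof.
rewrite /val_ring ext_val; case: (vf_val x) => //= g g0.
by rewrite -(raddf0 (ext_group e)) ext_group_mono.
Qed.

Variables (K E : vdField) (e : vdExt K E).

Lemma ext_iter_sigma j (x : K) : e (iter j (vd_sigma K) x) = iter j (vd_sigma E) (e x).
Proof. by elim: j => //= j <-; rewrite vdext_sigma. Qed.

(** Shifting [R] by the residues of the sigma^j(c) reduces to the maps [tau j] from the residue
    field of [K] to that of [E]. They are distinct by Axiom 2, hence algebraically independent in
    characteristic 0. *)
Lemma axiom2_generic n (R : {mpoly (vf_residue E)[n.+1]}) (c : E) :
  multiplicative_vd E -> axiom2 K -> R != 0 -> val_ring c ->
  exists2 mu : K, val_ring mu & R.@[fun j => vf_pi (sigma_vec (e mu + c) j)] != 0.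
Proof.
move=> [_ char0 _] ax2 R0 hc.
pose tau (j : 'I_n.+1) y := ext_residue e (iter j (@vd_sigma_residue K) y).
pose R' := shift_mpoly (fun j => vf_pi (sigma_vec c j)) R.
have R'0 : R' != 0.
  apply: contra_neq R0; rewrite -!mpolyC0; exact: shift_mpoly_eqC.
have [||||y hy] := @homs_algebraically_independent _ _ _ tau _ _ _ _ char0 R' R'0.
- by move=> j; rewrite /tau iter_sigma_residue1 rmorph1.
- by move=> j y z; rewrite /tau iter_sigma_residueM rmorphM.
- move=> i j ij; have [y hy] := @iter_sigma_residue_neq K ax2 i j ij.
  by exists y => /fmorph_inj.
- by move=> j y z; rewrite /tau iter_sigma_residueD rmorphD.
have [mu hmu muy] := vf_pi_surj y; exists mu => //.
move: hy; rewrite shift_mpolyE; congr (_ != _); apply: meval_eq => j.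
rewrite /sigma_vec iter_sigmaD vf_piD -?ext_iter_sigma; last 2 first.
- by apply/ext_val_ring/val_ring_sigma.
- exact: val_ring_sigma.
by rewrite ext_pi ?vf_pi_iter_sigma ?muy //; apply: val_ring_sigma.
Qed.

(** With c = (a - x) / theta, of value 0, the product theta (mu + c) equals b - x for b = a + mu
    theta. A generic residue is thus reached by a translate of [a] inside [K]. *)
Lemma generic_translate n (Hs : seq {mpoly E[n.+1]}) (x : E) (a theta : K) g :
  multiplicative_vd E -> axiom2 K -> {in Hs, forall H, H != 0} ->
  vf_val (x - e a) = Some g -> vf_val (e theta) = Some g ->
  exists2 b : K, vf_val (x - e b) = Some g &
    {in Hs, forall H, attains_min_term H (e b - x) (Some g)}.
Proof.
move=> hE ax2 Hs0 hxa hth; have [R R0 hR] := residual_polynomials Hs0 hth.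
pose c := (e a - x) / e theta; have th0 := val_Some_neq0 hth.
have hc : val_ring c.
  by rewrite /val_ring /c vf_valM (valV hth) valBC hxa /= subrr.
have [mu hmu /hR] := axiom2_generic hE ax2 R0 hc.
have dE : e theta * (e mu + c) = e (a + mu * theta) - x.
  rewrite mulrDr /c mulrC [e theta * _]mulrC divfK // rmorphD rmorphM.
  by rewrite mulrC addrC addrAC mulrC.
case=> [|vd hd]; first by apply: val_ringD => //; apply: ext_val_ring.
exists (a + mu * theta); last by move=> H /hd; rewrite dE.
by rewrite valBC -dE vf_valM hth vd /= addr0.
Qed.
End Extension.

(** * Pseudo-convergence *)

Section Eventually.
Variables (d : Order.disp_t) (I : orderType d).

Lemma eventually_impl (P Q : I -> Prop) :
  (forall i, P i -> Q i) -> eventually P -> eventually Q.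
Proof. by move=> PQ [i0 h]; exists i0 => i /h/PQ. Qed.

Lemma eventually_and (P Q : I -> Prop) :
  eventually P -> eventually Q -> eventually (fun i => P i /\ Q i).
Proof.
move=> [i0 h0] [i1 h1]; exists (Order.max i0 i1) => i.
by rewrite ge_max => /andP[/h0 ? /h1 ?].
Qed.

Lemma eventually_all (T : eqType) (s : seq T) (P : T -> I -> Prop) : inhabited I ->
  (forall x, x \in s -> eventually (P x)) ->
  eventually (fun i => forall x, x \in s -> P x i).
Proof.
move=> [i0]; elim: s => [|x s IH] h; first by exists i0.
have hx := h x (mem_head _ _).
have /(eventually_and hx) : eventually (fun i => forall x, x \in s -> P x i).
  by apply: IH => y ys; apply: h; rewrite inE ys orbT.
by apply: eventually_impl => i [hi1 hi2] y; rewrite inE => /predU1P[->|/hi2].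
Qed.

Lemma eventually_exists (P : I -> Prop) : eventually P -> exists i, P i.
Proof. by move=> [i h]; exists i; apply: h. Qed.

(** [pseudo_limit a x] unfolds to this property of the values v(x - a i). *)
Definition eventually_increasing (G : orderedGroup) (gam : I -> option G) :=
  exists i0, forall i j, (i0 <= i)%O -> (i < j)%O -> vlt (gam i) (gam j).

Hypothesis hI : limit_order I.

(** The index order has no last element, and oo is strictly below nothing. *)
Lemma increasing_Some (G : orderedGroup) (gam : I -> option G) :
  eventually_increasing gam -> eventually (fun i => exists g, gam i = Some g).
Proof.
move=> [i0 h]; exists i0 => i /h{}h; have [_ _ /(_ i)[j /h]] := hI.
by case: (gam i) => // g; exists g.
Qed.

Lemma increasing_pos (G : orderedGroup) (gam : I -> option G) :
  eventually_increasing gam -> exists g : G, 0 < g.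
Proof.
move=> incr; have [i1 h1] := increasing_Some incr; have [i0 h0] := incr.
pose i := Order.max i0 i1.
have i0i : (i0 <= i)%O by rewrite le_max lexx.
have i1i : (i1 <= i)%O by rewrite le_max lexx orbT.
have [_ _ /(_ i)[j ij]] := hI.
have [g hg] := h1 i i1i; have [h hh] := h1 j (le_trans i1i (ltW ij)).
have := h0 i j i0i ij; rewrite hg hh /= => gh.
by exists (h - g); rewrite og_subr_gt0.
Qed.

Variables (E : vdField) (gam : I -> option (vf_group E)).
Hypotheses (ax1 : axiom1 E) (gam_incr : eventually_increasing gam).

(** The first function minus the second increases strictly: either it is nonnegative at some index
    and positive at all later ones, or it stays negative. *)
Lemma eventually_compare_pos (t1 t2 : vf_group E) (L M : {poly int}) :
  rho_pos E (L - M) ->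
  let f t N i := vadd (Some t) (omap (rho_act (K := E) N) (gam i)) in
  eventually (fun i => vlt (f t1 L i) (f t2 M i)) \/
  eventually (fun i => vlt (f t2 M i) (f t1 L i)).
Proof.
have incr : eventually (fun i => forall j, (i < j)%O -> vlt (gam i) (gam j)).
  by have [i0 h] := gam_incr; exists i0 => i hi j; apply: h.
move=> pos f; have [i0 hi0] := eventually_and (increasing_Some gam_incr) incr.
have [[i [i0i hi]]|neg] := classic (exists i, (i0 <= i)%O /\ vle (f t2 M i) (f t1 L i)).
  right; have [_ _ /(_ i)[j ij]] := hI; exists j => l jl.
  have il := lt_le_trans ij jl; have [[g hg] /(_ l il)] := hi0 _ i0i.
  have [[h hh] _] := hi0 _ (le_trans i0i (ltW il)).
  move: hi; rewrite /f hg hh /= => h1 h2.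
  have := pos (h - g); rewrite og_subr_gt0 => /(_ h2).
  rewrite rho_actBl !rho_actB og_subr_gt0 => /og_ltD/(_ h1).
  by rewrite addrACA [X in _ < X]addrACA !addNr !addr0 ![_ + t1]addrC ![_ + t2]addrC.
left; exists i0 => i i0i; rewrite vltNge; apply/negP => h.
by apply: neg; exists i.
Qed.

(** Axiom 1 leaves two signs for [L - M]; the negative one becomes positive on exchanging the two
    functions. *)
Lemma eventually_compare (t1 t2 : vf_group E) (L M : {poly int}) :
  let f t N i := vadd (Some t) (omap (rho_act (K := E) N) (gam i)) in
  ~ rho_zero E (L - M) ->
  eventually (fun i => vlt (f t1 L i) (f t2 M i)) \/
  eventually (fun i => vlt (f t2 M i) (f t1 L i)).
Proof.
move=> f nz; case: (ax1.1 (L - M)) => [|[//|neg]]; first exact: eventually_compare_pos.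
apply/or_comm; apply: eventually_compare_pos => g /neg.
by rewrite !rho_actBl -og_subr_gt0 sub0r opprB.
Qed.

(** The eventual order on terms is total: equal slopes reduce to comparing constants, and different
    slopes are eventually strictly comparable. A least term is then strictly below every term of
    another slope. *)
Lemma dominant_term n (H : {mpoly E[n.+1]}) : H != 0 ->
  exists2 m0, m0 \in msupp H & forall m, m \in msupp H ->
    eventually (fun i => vle (term_val H m0 (gam i)) (term_val H m (gam i))) /\
    (~ rho_zero E (rho_deg m0 - rho_deg m) ->
     eventually (fun i => vlt (term_val H m0 (gam i)) (term_val H m (gam i)))).
Proof.
move=> H0; pose f m i := term_val H m (gam i).
have cmp m m' : m \in msupp H -> m' \in msupp H ->
    ~ rho_zero E (rho_deg m - rho_deg m') ->
    eventually (fun i => vlt (f m i) (f m' i)) \/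
    eventually (fun i => vlt (f m' i) (f m i)).
  rewrite !mcoeff_msupp /f /term_val => /val_neq0[t1 ->] /val_neq0[t2 ->].
  exact: eventually_compare.
have [|||m0 m0H hm0] := @seq_min_exists _
    (fun m m' => eventually (fun i => vle (f m i) (f m' i))) (msupp H).
- move=> m m' mH m'H.
  have [z|nz] := classic (rho_zero E (rho_deg m - rho_deg m')).
    move: mH m'H; rewrite !mcoeff_msupp /f /term_val.
    move=> /val_neq0[t1 ->] /val_neq0[t2 ->].
    have [[i]] := hI.
    have eqL g : omap (rho_act (K := E) (rho_deg m)) g = omap (rho_act (rho_deg m')) g.
      by case: g => //= g; congr Some; apply: ((rho_eq_zero E _ _).2 z g).
    by case/orP: (og_total t1 t2) => ht; [left|right]; exists i => l _;
      rewrite eqL; case: (gam l) => //= g; rewrite ![_ + rho_act _ _]addrC og_leD2lE.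
  by case: (cmp _ _ mH m'H nz) => h; [left|right];
    apply: eventually_impl h => i; apply: vltW.
- move=> m2 m1 m3 h12 h23; apply: eventually_impl (eventually_and h12 h23) => i [].
  exact: vle_trans.
- by rewrite msupp_eq0.
exists m0 => // m mH; split=> [|nz]; first exact: hm0.
case: (cmp _ _ m0H mH nz) => // h.
have [i [h1 h2]] := eventually_exists (eventually_and h (hm0 m mH)).
by have := vlt_le_trans h1 h2; rewrite vlt_irr.
Qed.

(** A nonzero multi-index has positive slope. This is the source of the pseudo-convergence of the
    values of P. *)
Lemma term_val_increasing n (H : {mpoly E[n.+1]}) m : m \in msupp H -> m != 0%MM ->
  eventually_increasing (fun i => term_val H m (gam i)).
Proof.
move=> mH m0; have [i0 hi0] := gam_incr; have [i1 hi1] := increasing_Some gam_incr.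
exists (Order.max i0 i1) => i j; rewrite ge_max => /andP[i0i i1i] ij.
have := hi0 i j i0i ij; have [g ->] := hi1 i i1i.
have [h ->] := hi1 j (le_trans i1i (ltW ij)).
move: mH; rewrite mcoeff_msupp /term_val => /val_neq0[t ->] /= gh.
rewrite og_ltD2lE -og_subr_gt0 -rho_actB rho_act_deg_gt0 //.
by rewrite og_subr_gt0.
Qed.

End Eventually.

(** * Pseudo-limits and equivalence of sequences *)

Section PseudoLimits.
Variables (d : Order.disp_t) (I : orderType d).
Hypothesis hI : limit_order I.

(** x - a_j has larger value than x - a_i. Hence gamma_i is the value of a difference of two members
    of the sequence. *)
Lemma val_pseudo_limit (E : valuedField) (a : I -> E) x : pseudo_limit a x ->
  eventually (fun i => forall j, (i < j)%O -> vf_val (a j - a i) = vf_val (x - a i)).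
Proof.
move=> [i0 h]; exists i0 => i hi j ij.
have -> : a j - a i = (x - a i) - (x - a j) by rewrite opprB [RHS]addrC addrA subrK.
by apply: val_ltD; rewrite valN; apply: h.
Qed.

Lemma pseudo_limit_congr (E : valuedField) (a b : I -> E) x :
  eventually (fun i => vf_val (x - b i) = vf_val (x - a i)) ->
  pseudo_limit a x -> pseudo_limit b x.
Proof.
move=> [i0 h0] [i1 h1]; exists (Order.max i0 i1) => i j.
rewrite ge_max => /andP[i0i i1i] ij.
by rewrite !h0 ?(le_trans i0i (ltW ij)) //; apply: h1.
Qed.

Variables (K E : valuedField) (e : vfExt K E).

Lemma vlt_ext (x y : K) : vlt (vf_val (e x)) (vf_val (e y)) = vlt (vf_val x) (vf_val y).
Proof.
rewrite !ext_val; case: (vf_val x) (vf_val y) => [g|] [h|] //=.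
by rewrite !og_ltNge ext_group_mono.
Qed.

Lemma pc_sequence_of_limit (a : I -> K) x :
  pseudo_limit (fun i => e (a i)) x -> pc_sequence a.
Proof.
move=> hx; have [i0 h0] := val_pseudo_limit hx; have [i1 h1] := hx.
exists (Order.max i0 i1) => i j k; rewrite ge_max => /andP[i0i i1i] ij jk.
rewrite -vlt_ext !rmorphB h0 // h0 ?(le_trans i0i (ltW ij)) //.
exact: h1.
Qed.

(** [x] and [y] lie in unrelated extensions, so the comparison passes through [K]: [x] gives v(a_j -
    b_i) = v(a_j - a_i) there, and this equality is carried to [F]. *)
Lemma pseudo_limit_transfer (a b : I -> K) x (F : valuedField) (f : vfExt K F) y :
  pseudo_limit (fun i => e (a i)) x ->
  eventually (fun i => vf_val (x - e (b i)) = vf_val (x - e (a i))) ->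
  pseudo_limit (fun i => f (a i)) y -> pseudo_limit (fun i => f (b i)) y.
Proof.
move=> hx hb hy; apply: pseudo_limit_congr (hy).
have [i0 {hb} h0] :=
  eventually_and (eventually_and hb (val_pseudo_limit hx)) (val_pseudo_limit hy).
have [i1 h1] := hx; have [i2 h2] := hy.
exists (Order.max i0 (Order.max i1 i2)) => i; rewrite !ge_max => /and3P[i0i i1i i2i].
have [[hb hax] hay] := h0 i i0i; have [_ _ /(_ i)[j ij]] := hI.
have Kab : vf_val (a j - b i) = vf_val (a j - a i).
  apply/(ext_val_inj e); rewrite rmorphB [in RHS]rmorphB hax //.
  have -> : e (a j) - e (b i) = (x - e (b i)) - (x - e (a j)).
    by rewrite opprB [RHS]addrC addrA subrK.
  by rewrite val_ltD hb // valN; apply: h1.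
have fab : vf_val (f (a j) - f (b i)) = vf_val (y - f (a i)).
  by rewrite -(hay j) // -!rmorphB; apply/(ext_val_inj f).
have -> : y - f (b i) = (f (a j) - f (b i)) + (y - f (a j)).
  by rewrite [RHS]addrC addrA subrK.
by rewrite val_ltD fab //; apply: h2.
Qed.

Lemma pc_equivalent_of_limit (a b : I -> K) x :
  pseudo_limit (fun i => e (a i)) x ->
  eventually (fun i => vf_val (x - e (b i)) = vf_val (x - e (a i))) ->
  pc_equivalent a b.
Proof.
move=> hx hb F f y; split; first exact: pseudo_limit_transfer hx hb.
apply: pseudo_limit_transfer (pseudo_limit_congr hb hx) _.
by apply: eventually_impl hb => i ->.
Qed.
End PseudoLimits.

(** * Sigma-polynomials along a pseudo-convergent sequence *)

Section Increment.
Variables (K E : vdField) (e : vdExt K E) (x : E) (n : nat).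
Implicit Types F : {mpoly K[n.+1]}.

(* P(x + y) - P(x) as a polynomial in sigma_vec y: its coefficients are the
   P_(m)(x) with m <> 0. *)
Definition increment F : {mpoly E[n.+1]} :=
  shift_mpoly (sigma_vec x) (sp_map e F) - (sp_eval (sp_map e F) x)%:MP.

Lemma increment_coef F m : m != 0%MM ->
  (increment F)@_m = sp_eval (sp_map e (taylor F m)) x.
Proof.
move=> m0; rewrite /sp_eval /sp_map taylor_meval mcoeffB mcoeffC (negPf m0).
by rewrite mulr0 subr0.
Qed.

Lemma increment_coef0 F : (increment F)@_0%MM = 0.
Proof.
rewrite mcoeffB mcoeffC eqxx mulr1 -meval0_mcoeff shift_mpolyE.
by apply/eqP; rewrite subr_eq0; apply/eqP/meval_eq => i; rewrite add0r.
Qed.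

Lemma increment_eval F c : (increment F).@[sigma_vec (e c - x)] =
  e (sp_eval F c) - sp_eval (sp_map e F) x.
Proof.
rewrite mevalB mevalC shift_mpolyE -meval_map_mpoly; congr (_ - _).
apply: meval_eq => i; rewrite /= /sigma_vec iter_sigmaB subrK.
by rewrite ext_iter_sigma.
Qed.

(** Shifting is invertible and the field embedding injective, so a zero increment would make [F]
    constant. *)
Lemma increment_neq0 F : nonconstant F -> increment F != 0.
Proof.
move=> ncF; apply/eqP => /eqP; rewrite subr_eq0 => /eqP /shift_mpoly_eqC h.
apply: (ncF F@_0%MM); apply/mpolyP => m; rewrite mcoeffC.
have [->|m0] := eqVneq m 0%MM; first by rewrite mulr1.
have := congr1 (fun p => p@_m) h.
rewrite mcoeff_map_mpoly mcoeffC (negPf m0) !mulr0 => /eqP.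
by rewrite fmorph_eq0 => /eqP.
Qed.

Lemma msupp_increment F m : m \in msupp (increment F) -> m != 0%MM.
Proof. by rewrite mcoeff_msupp; apply: contraNneq => ->; rewrite increment_coef0. Qed.
End Increment.

Lemma same_rho_zero (K E : vdField) L : same_rho K E -> rho_zero K L <-> rho_zero E L.
Proof. by case/(_ L). Qed.

Theorem theorem4p3
  (K : vdField) (hK : multiplicative_vd K) (hK2 : axiom2 K)
  (d : Order.disp_t) (I : orderType d) (hI : limit_order I)
  (a : I -> K) (ha : pc_sequence a)
  (E : vdField) (hE : multiplicative_vd E) (e : vdExt K E) (hrho : same_rho K E)
  (x : E) (hx : pseudo_limit (fun i => e (a i)) x)
  (n : nat) (Sigma : seq {mpoly K[n.+1]}) :
  let gam (i : I) : option (vf_group E) := vf_val (x - e (a i)) in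
  (* the value v(P_(m)(x)) + |m|_rho . gam_i *)
  let term (F : {mpoly K[n.+1]}) (m : 'X_{1..n.+1}) (i : I) :=
    vadd (vf_val (sp_eval (sp_map e (taylor F m)) x))
         (omap (rho_act (K := E) (rho_deg m)) (gam i)) in
  (* the value v(P(c_i) - P(x)) *)
  let diff (F : {mpoly K[n.+1]}) (c : I -> K) (i : I) :=
    vf_val (e (sp_eval F (c i)) - sp_eval (sp_map e F) x) in
  (rho_transcendental K ->
   forall F : {mpoly K[n.+1]}, nonconstant F ->
     pseudo_limit (fun i => e (sp_eval F (a i))) (sp_eval (sp_map e F) x) /\
     exists! L0 : 'X_{1..n.+1},
       forall m : 'X_{1..n.+1}, m <> L0 -> (1 <= mdeg m)%N ->
         eventually (fun i =>
           diff F a i = term F L0 i /\ vlt (term F L0 i) (term F m i)))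
  /\
  (rho_algebraic K ->
   exists b : I -> K,
     [/\ pc_sequence b, pc_equivalent a b
       & forall F : {mpoly K[n.+1]}, F \in Sigma -> nonconstant F ->
         pseudo_limit (fun i => e (sp_eval F (b i))) (sp_eval (sp_map e F) x) /\
         exists_unique_mod (rho_eq K) (fun m0 : {poly int} =>
           forall m : 'X_{1..n.+1}, (1 <= mdeg m)%N ->
             ~ rho_eq K (rho_deg m) m0 ->
             eventually (fun i =>
               is_vmin (fun L0 : 'X_{1..n.+1} => rho_eq K (rho_deg L0) m0)
                       (fun L0 => term F L0 i) (diff F b i) /\
               vlt (diff F b i) (term F m i)))]).

Proof.
move=> gam term diff; have [inhI _ _] := hI.
have ax1E : axiom1 E by case: hE.
have gam_incr : eventually_increasing gam by exact: hx.
have gam_Some := increasing_Some hI gam_incr.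
pose H (F : {mpoly K[n.+1]}) := increment e x F.
have termE F m i : m != 0%MM -> term F m i = term_val (H F) m (gam i).
  by move=> m0; rewrite /term_val increment_coef.
have diffE F c i : diff F c i = vf_val (H F).@[sigma_vec (e (c i) - x)].
  by rewrite /H increment_eval.
(* [same_rho] moves the slope condition from [K] to [E]. The strict inequality extends to all
   multi-indices, terms outside the support being oo. *)
have dom F : nonconstant F -> exists2 m0, m0 \in msupp (H F) &
    eventually (fun i => forall m, m \in msupp (H F) ->
      vle (term_val (H F) m0 (gam i)) (term_val (H F) m (gam i))) /\
    (forall m, ~ rho_zero K (rho_deg m0 - rho_deg m) -> eventually (fun i =>
      vlt (term_val (H F) m0 (gam i)) (term_val (H F) m (gam i)))).
  move=> /(increment_neq0 e x) /(dominant_term hI ax1E gam_incr)[m0 m0H hm0].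
  exists m0 => //; split.
    by apply: (eventually_all inhI) => m /hm0[].
  move=> m nz; have [mH|mH] := boolP (m \in msupp (H F)).
    by apply: (hm0 m mH).2 => /(same_rho_zero _ hrho).
  apply: eventually_impl gam_Some => i [g ->]; rewrite (term_val_None _ mH).
  by have [t ->] := term_val_Some g m0H.
have lim F c m0 : m0 \in msupp (H F) ->
    eventually (fun i => diff F c i = term_val (H F) m0 (gam i)) ->
    pseudo_limit (fun i => e (sp_eval F (c i))) (sp_eval (sp_map e F) x).
  move=> m0H [i0 hd].
  have [i1 h1] := term_val_increasing hI ax1E gam_incr m0H (msupp_increment m0H).
  exists (Order.max i0 i1) => i j; rewrite ge_max => /andP[i0i i1i] ij.
  rewrite valBC [X in vlt _ X]valBC -/(diff F c i) -/(diff F c j) !hd //.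
    exact: h1.
  exact: le_trans i0i (ltW ij).
split=> [tr F ncF|alg].
  have [m0 m0H [_ hlt]] := dom F ncF.
  (* Distinct multi-indices give distinct polynomials in rho, whose nonzero difference cannot act as
     0 when rho is transcendental. *)
  have nz m : m != m0 -> ~ rho_zero K (rho_deg m0 - rho_deg m).
    move=> mm0 z; apply: tr; exists (rho_deg m0 - rho_deg m); last exact/rho_zero_act.
    by rewrite subr_eq0; apply: contra_neq mm0 => /rho_deg_inj.
  have m00 := msupp_increment m0H.
  have hd : eventually (fun i => diff F a i = term_val (H F) m0 (gam i)).
    have hs : eventually (fun i => forall m, m \in msupp (H F) -> m != m0 ->
        vlt (term_val (H F) m0 (gam i)) (term_val (H F) m (gam i))).
      apply: (eventually_all inhI) => m _; have [->|mm0] := eqVneq m m0.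
        by case: inhI => i; exists i.
      by apply: eventually_impl (hlt m (nz m mm0)).
    apply: eventually_impl (eventually_and gam_Some hs) => i [[g hg]].
    by rewrite diffE hg => /val_strict_min; apply=> //; rewrite valBC.
  split; first exact: lim hd.
  exists m0; split=> [m /eqP mm0 m1|m' hm'].
    apply: eventually_impl (eventually_and hd (hlt m (nz m mm0))) => i [-> h].
    by rewrite !termE // -mdeg_eq0 -lt0n.
  (* The property of a second candidate [m'], applied to the index [m0], would put the value of the
     difference strictly below itself. *)
  apply/eqP/negP => /negP m0m'.
  have [||i [h1 [h2 h3]]] := eventually_exists (eventually_and hd (hm' m0 _ _)).
  - exact/eqP.
  - by rewrite lt0n mdeg_eq0.
  by move: h3; rewrite -h2 h1 termE // vlt_irr.
pose good i c := vf_val (x - e c) = gam i /\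
  forall F, F \in Sigma -> nonconstant F ->
    attains_min_term (H F) (e c - x) (gam i).
(* Early indices may admit no good element; [b i] is then arbitrary, which eventual statements do
   not see. *)
pose b i := epsilon (inhabits (0 : K)) (good i).
have hb : eventually (fun i => good i (b i)).
  apply: eventually_impl (eventually_and gam_Some (val_pseudo_limit hx)).
  move=> i [[g hg] hi].
  apply: epsilon_spec; have [_ _ /(_ i)[j /hi hj]] := hI.
  (* The filter discards the zero increments, which come from constant members of [Sigma]. *)
  pose Hs := [seq G <- [seq H F | F <- Sigma] | G != 0].
  (* Here theta is [a j - a i] with [j] after [i]: it lies in [K] and has value gamma_i. *)
  have [||c hc hHs] := @generic_translate K E e n Hs x (a i) (a j - a i) g hE hK2 _ hg.
  - by move=> G; rewrite mem_filter => /andP[].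
  - by rewrite rmorphB hj.
  exists c; split=> [|F FS ncF]; first by rewrite hg.
  by rewrite hg; apply: hHs; rewrite mem_filter increment_neq0 // map_f.
have hbv : eventually (fun i => vf_val (x - e (b i)) = vf_val (x - e (a i))).
  by apply: eventually_impl hb => i [].
exists b; split.
- exact: pc_sequence_of_limit (pseudo_limit_congr hbv hx).
- exact: (pc_equivalent_of_limit hI hx hbv).
move=> F FS ncF; have [m0 m0H [hle hlt]] := dom F ncF.
have m00 := msupp_increment m0H.
have hd : eventually (fun i => diff F b i = term_val (H F) m0 (gam i)).
  apply: eventually_impl (eventually_and hb hle) => i [[_ hg] hi].
  (* This [m] depends on [i]; minimality on both sides identifies its term value with that of the
     fixed [m0]. *)
  have [m mH [hm1 hm2]] := hg F FS ncF; rewrite diffE hm1.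
  by apply: vle_anti; [apply: hm2 | apply: hi].
split; first exact: lim hd.
exists (rho_deg m0); split=> [m m1 neq|y hy]; last first.
  apply: NNPP => neq.
  have [||i [h1 [_]]] := eventually_exists (eventually_and hd (hy m0 _ _)).
  - by rewrite lt0n mdeg_eq0.
  - exact: neq.
  by rewrite h1 termE // vlt_irr.
have nz : ~ rho_zero K (rho_deg m0 - rho_deg m).
  by move/rho_eq_zero => h; apply: neq => g; rewrite h.
have [g g0] : exists g : vf_group E, 0 < g.
  exact: (increasing_pos hI gam_incr).
apply: eventually_impl (eventually_and (eventually_and hd hle) (hlt m nz)).
move=> i [[h1 h2] h3].
split; last by rewrite h1 termE // -mdeg_eq0 -lt0n.
split; first by exists m0; rewrite ?termE.
move=> t ht; rewrite h1.
(* The index 0 must be excluded, as its Taylor coefficient is P itself while the increment has no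
   constant term. Its slope is 0, whereas that of [m0] is positive. *)
have t0 : t != 0%MM.
  apply/eqP => t0; have := rho_act_deg_gt0 ax1E m00 g0.
  have /(same_rho_zero _ hrho)/(rho_eq_zero E) <- : rho_zero K (rho_deg t - rho_deg m0).
    exact/rho_eq_zero.
  rewrite rho_act_deg big1 ?ltxx // => j _.
  by rewrite t0 mnm0E mulr0n.
rewrite termE //; have [tH|tH] := boolP (t \in msupp (H F)); first exact: h2.
by rewrite (term_val_None _ tH) vle_None.
Qed.
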